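(* Let $\{V_n\}_{n\geq 0}$ be the sequence defined by $V_0=1$, $V_1=8$ and \[ n(n+1)^2 V_{n+1}=8n(3n^2+5n+1)V_n-128(n-1)(n+1)^2V_{n-1}, \quad \text{for } n\geq 1. \] Then $V_n^2\geq V_{n-1}V_{n+1}$ for every $n\geq 2$.
   Context: The sequence $\{V_n\}$ is the Fennessey-Larcombe-French sequence. *)

(* Defs.v *)
From mathcomp Require Export all_boot all_order all_algebra.
Set Implicit Arguments.
Unset Strict Implicit.
Unset Printing Implicit Defensive.
Export Order.TTheory GRing.Theory Num.Theory.

Local Open Scope ring_scope.

(* The division-free recurrence determines the sequence, since the coefficient
   n (n + 1)^2 of V_(n+1) is nonzero for n >= 1. The subtraction n - 1 in the
   coefficients is that of R; the index n.-1 is only used for n >= 1. *)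
Definition fennessey_larcombe_french (R : realFieldType) (V : nat -> R) : Prop :=
  [/\ V 0%N = 1,
      V 1%N = 8%:R
    & forall n : nat, (1 <= n)%N ->
        n%:R * (n%:R + 1) ^+ 2 * V n.+1 =
          8%:R * n%:R * (3%:R * n%:R ^+ 2 + 5%:R * n%:R + 1) * V n
          - 128%:R * (n%:R - 1) * (n%:R + 1) ^+ 2 * V n.-1].

(* Main.v *)
Require Import Defs.
From mathcomp Require Import all_boot all_order all_algebra.
From mathcomp Require Import ring lra.
Set Implicit Arguments.
Unset Strict Implicit.
Unset Printing Implicit Defensive.
Local Open Scope ring_scope.

(** Divided by n (n + 1)^2, the recurrence reads V_(n+1) = a_n V_n - b_n V_(n-1),
    so log-concavity at n says that r_n = V_n / V_(n-1) satisfies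
    r^2 - a_n r + b_n >= 0, i.e. it is not between the roots of this quadratic.
    The larger root is 16 + 16 / n^3 + O(1 / n^4), and f_n = 16 + 16 / n^3 is at
    least this root. As r_(n+1) = a_n - b_n / r_n and f_(n+1) <= a_n - b_n / f_n,
    the bound r_n >= f_n propagates by induction from r_2 = 18 = f_2. *)

Definition flf_a (R : realFieldType) (x : R) : R :=
  8%:R * (3%:R * x ^+ 2 + 5%:R * x + 1) / (x + 1) ^+ 2.

Definition flf_b (R : realFieldType) (x : R) : R := 128%:R * (x - 1) / x.

Definition ratio_bound (R : realFieldType) (x : R) : R := 16%:R + 16%:R / x ^+ 3.

Lemma flf_step (R : realFieldType) (V : nat -> R) (n : nat) :
  fennessey_larcombe_french V -> (1 <= n)%N ->
  V n.+1 = flf_a n%:R * V n - flf_b n%:R * V n.-1.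
Proof.
case=> _ _ hrec hn; have {hrec} := hrec n hn.
have x0 : n%:R != 0 :> R by rewrite pnatr_eq0 -lt0n.
have x1 : n%:R + 1 != 0 :> R by rewrite natr1 pnatr_eq0.
move=> e; apply: (mulfI (mulf_neq0 x0 (expf_neq0 2 x1))).
by rewrite e /flf_a /flf_b; field; rewrite x1 x0.
Qed.

Lemma ratio_bound_ge16 (R : realFieldType) (x : R) :
  0 < x -> 16%:R <= ratio_bound x.
Proof. by move=> x0; rewrite lerDl divr_ge0 ?exprn_ge0 ?ltW ?ltr0n. Qed.

Lemma flf_a_le (R : realFieldType) (x : R) : 0 < x -> flf_a x <= 24%:R.
Proof.
move=> x0; rewrite /flf_a ler_pdivrMr; last by apply: exprn_gt0; lra.
nra.
Qed.

(** The factored form shows the sign for [1 <= x], which allows multiplying by this difference in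
    the induction. *)
Lemma flf_a_sub_ratio_bound (R : realFieldType) (x : R) : 0 < x ->
  flf_a x - ratio_bound (x + 1) =
  8%:R * (x - 1) * (x ^+ 2 + 3%:R * x + 3%:R) / (x + 1) ^+ 3.
Proof.
move=> x0; rewrite /flf_a /ratio_bound; field.
by apply: lt0r_neq0; lra.
Qed.

Lemma ratio_bound_subsolution (R : realFieldType) (x : R) : 1 <= x ->
  flf_b x <= (flf_a x - ratio_bound (x + 1)) * ratio_bound x.
Proof.
move=> hx; rewrite flf_a_sub_ratio_bound; last by lra.
rewrite -subr_ge0.
have -> : 8%:R * (x - 1) * (x ^+ 2 + 3%:R * x + 3%:R) / (x + 1) ^+ 3
    * ratio_bound x - flf_b x = 384%:R * (x - 1) / (x ^+ 3 * (x + 1) ^+ 2).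
  by rewrite /ratio_bound /flf_b; field; apply/andP; split; apply: lt0r_neq0; lra.
by rewrite divr_ge0 ?mulr_ge0 ?exprn_ge0 ?ler0n //; lra.
Qed.

(** After clearing denominators, the numerator has only positive coefficients. *)
Lemma quadratic_ratio_bound_ge0 (R : realFieldType) (x : R) : 1 <= x ->
  0 <= ratio_bound x ^+ 2 - flf_a x * ratio_bound x + flf_b x.
Proof.
move=> hx.
have -> : ratio_bound x ^+ 2 - flf_a x * ratio_bound x + flf_b x =
    128%:R * (3%:R * x ^+ 4 + 3%:R * x ^+ 3 + 2%:R * x ^+ 2 + 4%:R * x + 2%:R)
    / (x ^+ 6 * (x + 1) ^+ 2).
  by rewrite /ratio_bound /flf_a /flf_b; field; apply/andP; split; apply: lt0r_neq0; lra.
have x0 : 0 <= x by lra.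
by rewrite divr_ge0 ?mulr_ge0 ?addr_ge0 ?exprn_ge0 ?mulr_ge0 ?exprn_ge0 ?ler0n.
Qed.

(** The bound starts at the ratio of [V 2] to [V 1]: it fails one index earlier, where the ratio is
    8 and the bound 32. Positivity is carried along to multiply inequalities by [V n.+1]. *)
Lemma flf_ratio (R : realFieldType) (V : nat -> R) (n : nat) :
  fennessey_larcombe_french V ->
  0 < V n.+1 /\ ratio_bound n.+2%:R * V n.+1 <= V n.+2.
Proof.
move=> hV; elim: n => [|n [V1 hr]].
  have := @flf_step R V 1 hV isT; case: (hV) => V0 V1 _ /= ->.
  rewrite V0 V1 ltr0n; split=> //.
  have -> : flf_a 1 = 18%:R :> R by rewrite /flf_a; field.
  have -> : ratio_bound 2%:R = 18%:R :> R by rewrite /ratio_bound; field.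
  by rewrite /flf_b subrr mulr0 mul0r mul0r subr0.
set x : R := n.+2%:R in hr.
have hx : 1 <= x by rewrite ler1n.
have x0 : 0 < x by rewrite ltr0n.
have V2 : 0 < V n.+2.
  by apply: lt_le_trans hr; rewrite mulr_gt0 // (lt_le_trans _ (ratio_bound_ge16 x0)) ?ltr0n.
split=> //.
rewrite (@flf_step R V n.+2 hV isT) -(natr1 n.+2) -/x /=.
have hs := ratio_bound_subsolution hx.
have hd : 0 <= flf_a x - ratio_bound (x + 1).
  by rewrite flf_a_sub_ratio_bound // divr_ge0 ?mulr_ge0 ?exprn_ge0 //; nra.
(* Chaining through [(flf_a x - ratio_bound (x + 1)) * ratio_bound x * V n.+1] gives the next bound
   without division. *)
have h1 := ler_wpM2l hd hr; have h2 := ler_wpM2r (ltW V1) hs.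
lra.
Qed.

Theorem theorem2p2 (R : realFieldType) (V : nat -> R)
    (hV : fennessey_larcombe_french V) (n : nat) (hn : (2 <= n)%N) :
  V n ^+ 2 >= V n.-1 * V n.+1.
Proof.
case: n hn => [|[|n]] // _.
rewrite (@flf_step R V n.+2 hV isT) /=.
have [V1 hr] := flf_ratio n hV.
set x : R := n.+2%:R in hr *.
have hx : 1 <= x by rewrite ler1n.
have x0 : 0 < x by rewrite ltr0n.
have hq := quadratic_ratio_bound_ge0 hx.
have ha := flf_a_le x0; have hf := ratio_bound_ge16 x0.
set u := V n.+1 in V1 hr *; set v := V n.+2 in hr *.
set f := ratio_bound x in hr hq hf; set a := flf_a x in hq ha *.
set b := flf_b x in hq *.
(* Since [v >= f * u], this is at least [(2 f - a) * u], and [2 f - a >= 32 - 24]. *)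
have hs : 0 <= v + (f - a) * u by nra.
rewrite -subr_ge0.
(* The quadratic form in [v] and [u] is expanded around [v = f * u], so no root has to be
   extracted. *)
have -> : v ^+ 2 - u * (a * v - b * u) =
    (v - f * u) * (v + (f - a) * u) + u ^+ 2 * (f ^+ 2 - a * f + b) by ring.
by rewrite addr_ge0 // mulr_ge0 ?subr_ge0 ?sqr_ge0.
Qed.
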